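(* For any integers $k\leq 0$ and $n\geq 1$, and any local field $L$, we have $Y_L(n,k)=0$. Also, for any $n\geq 1$ and any local field $L$, $Y_L(n,1)=Y_L(1,1)^n$. In particular, $Y_{\mathbb{Q}_2}(n,1)=2^n$, and $Y_L(n,1)=1$ for all $L\in\{\mathbb{C},\mathbb{R}\}\cup\{\mathbb{Q}_3,\mathbb{Q}_5,\ldots\}\cup\{\mathbb{F}_q((t))\ |\ q\text{ a prime power}\}$ (where $\{\mathbb{Q}_3,\mathbb{Q}_5,\ldots\}$ is the set of all $\mathbb{Q}_p$ with $p$ an odd prime).
   Context: A local field $L$ means: $\mathbb{C}$, $\mathbb{R}$, any finite algebraic extension of $\mathbb{Q}_p$ ($p$ prime), or $\mathbb{F}_q((t))$ ($q$ a prime power). An $(n+k)$-nomial $n\times n$ system over $L$ is a tuple $F=(f_1,\ldots,f_n)$ of Laurent polynomials $f_i\in L[x_1^{\pm1},\ldots,x_n^{\pm1}]$ such that the total number of distinct exponent vectors in the monomial term expansions of $f_1,\ldots,f_n$ is $n+k$. A root of $F$ is non-degenerate if the Jacobian matrix of $F$ at it has rank $n$. Generalized phase: for $y\in L^*$ with $L\in\{\mathbb{R},\mathbb{C}\}$, $\phi(y):=y/|y|$. For $L$ non-Archimedean, let $\mathfrak{M}$ be the maximal ideal of the ring of integers of $L$, fix a uniformizer $\rho$ (a generator of $\mathfrak{M}$), let $\mathrm{ord}$ be the corresponding valuation (so $\mathrm{ord}\,\rho=1$), and set $\phi(y):=\frac{y}{\rho^{\mathrm{ord}\, y}} \bmod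 \mathfrak{M}$. $Y_L(n,k)$ is the supremum, over all $(n+k)$-nomial $n\times n$ systems $F$ over $L$, of the number of non-degenerate roots of $F$ in $L^n$ all of whose coordinates have generalized phase $1$; the supremum over an empty collection of systems (when $n+k<0$) is taken to be $0$. *)

(* Defs.v *)
From HB Require Import structures.
From mathcomp Require Import all_boot all_order all_algebra all_field finmap.
From mathcomp Require Import all_classical all_reals all_analysis.
From mathcomp.real_closed Require Import complex.

Set Implicit Arguments.
Unset Strict Implicit.
Unset Printing Implicit Defensive.

Import Order.TTheory GRing.Theory Num.Theory.

Local Open Scope ring_scope.
Local Open Scope classical_set_scope.

Section ClassicalInverse.
Variable R : comNzRingType.

Definition classical_unit : pred R := fun x => `[< exists y, y * x = 1 >].

Definition classical_inv (x : R) : R :=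
  if pselect (exists y, y * x = 1) is left h then projT1 (cid h) else x.

Lemma classical_mulVr : {in classical_unit, left_inverse 1 classical_inv *%R}.
Proof.
move=> x; rewrite unfold_in => /asboolP xU; rewrite /classical_inv.
by case: pselect => // h; case: cid.
Qed.

Lemma classical_unitP (x y : R) : y * x = 1 -> classical_unit x.
Proof. by move=> yx; apply/asboolP; exists y. Qed.

Lemma classical_inv_out : {in [predC classical_unit], classical_inv =1 id}.
Proof.
move=> x; rewrite inE => /asboolPn xNU; rewrite /classical_inv.
by case: pselect.
Qed.

End ClassicalInverse.

(* The ring Z_p of p-adic integers, as the inverse limit of the Z/p^n: the
   n-th entry is the residue modulo p ^ n in [0, p ^ n[. The primality proof
   is a parameter of the type because the ring structure depends on it. *)
Record padic_int (p : nat) (p_pr : prime p) : Type := PadicInt {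
  padic_res :> nat -> nat;
  padic_coherent : forall n, padic_res n = (padic_res n.+1 %% p ^ n)%N
}.

Section PadicInt.
Variables (p : nat) (p_pr : prime p).
Local Notation Zp := (padic_int p_pr).

HB.instance Definition _ := gen_eqMixin Zp.
HB.instance Definition _ := gen_choiceMixin Zp.

Lemma padic_intP (x y : Zp) : (forall n, x n = y n) -> x = y.
Proof.
case: x y => [x hx] [y hy] /= /funext exy; subst y.
by congr PadicInt; apply: Prop_irrelevance.
Qed.

Lemma padic_res_small (x : Zp) n : (x n %% p ^ n)%N = x n.
Proof. by rewrite {1}[x n]padic_coherent modn_mod -padic_coherent. Qed.

Lemma padic_resD (x : Zp) n m : (x (n + m) %% p ^ n)%N = x n.
Proof.
elim: m => [|m IH]; first by rewrite addn0 padic_res_small.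
rewrite -[RHS]IH addnS [x (n + m)%N]padic_coherent modn_dvdm //.
by rewrite dvdn_exp2l // leq_addr.
Qed.

Lemma dvdn_expS n : (p ^ n %| p ^ n.+1)%N.
Proof. exact: dvdn_exp2l. Qed.

Definition padic_mk (u : nat -> nat)
    (hu : forall n, u n = u n.+1 %[mod p ^ n]) : Zp.
Proof.
exists (fun n => u n %% p ^ n)%N => n.
by rewrite modn_dvdm ?dvdn_expS.
Defined.

Lemma padic_step (x : Zp) n : x n = x n.+1 %[mod p ^ n].
Proof. by rewrite {1}[x n]padic_coherent modn_mod. Qed.

Lemma padic_add_subproof (x y : Zp) n :
  x n + y n = x n.+1 + y n.+1 %[mod p ^ n].
Proof. by rewrite -modnDm padic_step (padic_step y) modnDm. Qed.

Lemma padic_mul_subproof (x y : Zp) n :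
  x n * y n = x n.+1 * y n.+1 %[mod p ^ n].
Proof. by rewrite -modnMm padic_step (padic_step y) modnMm. Qed.

Lemma padic_expn_gt0 n : (0 < p ^ n)%N.
Proof. by rewrite expn_gt0 prime_gt0. Qed.

Lemma padic_res_lt (x : Zp) n : (x n < p ^ n)%N.
Proof. by rewrite -padic_res_small ltn_pmod ?padic_expn_gt0. Qed.

Lemma padic_opp_subproof (x : Zp) n :
  p ^ n - x n = p ^ n.+1 - x n.+1 %[mod p ^ n].
Proof.
apply/eqP; rewrite -(eqn_modDr (x n.+1)) subnK; last exact/ltnW/padic_res_lt.
rewrite -modnDmr -padic_step modnDmr subnK; last exact/ltnW/padic_res_lt.
by rewrite modnn; apply/eqP/esym/eqP; exact: dvdn_expS.
Qed.

Definition padic_zero : Zp := @padic_mk (fun=> 0%N) (fun=> erefl).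
Definition padic_one : Zp := @padic_mk (fun=> 1%N) (fun=> erefl).
Definition padic_add (x y : Zp) : Zp := padic_mk (padic_add_subproof x y).
Definition padic_mul (x y : Zp) : Zp := padic_mk (padic_mul_subproof x y).
Definition padic_opp (x : Zp) : Zp := padic_mk (padic_opp_subproof x).

Lemma padic_addA : associative padic_add.
Proof. by move=> x y z; apply: padic_intP => n /=; rewrite modnDml modnDmr addnA. Qed.
Lemma padic_addC : commutative padic_add.
Proof. by move=> x y; apply: padic_intP => n /=; rewrite addnC. Qed.
Lemma padic_add0 : left_id padic_zero padic_add.
Proof. by move=> x; apply: padic_intP => n /=; rewrite mod0n padic_res_small. Qed.
Lemma padic_addN : left_inverse padic_zero padic_opp padic_add.
Proof.
move=> x; apply: padic_intP => n /=.
by rewrite modnDml subnK ?modnn ?mod0n //; exact/ltnW/padic_res_lt.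
Qed.

HB.instance Definition _ :=
  GRing.isZmodule.Build Zp padic_addA padic_addC padic_add0 padic_addN.

Lemma padic_mulA : associative padic_mul.
Proof. by move=> x y z; apply: padic_intP => n /=; rewrite modnMml modnMmr mulnA. Qed.
Lemma padic_mulC : commutative padic_mul.
Proof. by move=> x y; apply: padic_intP => n /=; rewrite mulnC. Qed.
Lemma padic_mul1 : left_id padic_one padic_mul.
Proof. by move=> x; apply: padic_intP => n /=; rewrite modnMml mul1n padic_res_small. Qed.
Lemma padic_mulD : left_distributive padic_mul padic_add.
Proof.
by move=> x y z; apply: padic_intP => n /=; rewrite modnMml modnDm mulnDl.
Qed.
Lemma padic_oner_neq0 : padic_one != padic_zero.
Proof.
apply/eqP => /(congr1 (fun x : Zp => x 1%N)) /=.
by rewrite mod0n modn_small // expn1 prime_gt1.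
Qed.

HB.instance Definition _ := GRing.Zmodule_isComNzRing.Build Zp
  padic_mulA padic_mulC padic_mul1 padic_mulD padic_oner_neq0.

HB.instance Definition _ := GRing.ComNzRing_hasMulInverse.Build Zp
  (@classical_mulVr Zp) (@classical_unitP Zp) (@classical_inv_out Zp).

Lemma padic_neq0 (x : Zp) : x != 0 -> exists a, forall m, ~~ (p ^ a %| x (a + m))%N.
Proof.
move=> /eqP x0; apply: contrapT => /forallNP h; apply: x0.
apply: padic_intP => n /=; rewrite mod0n.
have /existsNP[m /negP] := h n; rewrite negbK => /eqP.
by rewrite padic_resD.
Qed.

Lemma padic_mulf_eq0 (x y : Zp) : x * y = 0 -> (x == 0) || (y == 0).
Proof.
move=> xy0; case: eqVneq => //= /padic_neq0[a xa].
case: eqVneq => //= /padic_neq0[b yb].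
have := congr1 (fun z : Zp => z (a + b)%N) xy0; rewrite /= mod0n => /eqP.
rewrite -/(dvdn _ _) => d.
have {}xa := xa b; have {}yb := yb a; rewrite addnC in yb.
have x_gt0 : (0 < x (a + b))%N by case: (x _) xa => //; rewrite dvdn0.
have y_gt0 : (0 < y (a + b))%N by case: (y _) yb => //; rewrite dvdn0.
move: d xa yb; rewrite !pfactor_dvdn ?muln_gt0 ?x_gt0 // lognM //.
by rewrite -!ltnNge => d xa yb; have := leq_trans (leq_add xa (ltnW yb)) d;
   rewrite addSn ltnn.
Qed.

HB.instance Definition _ := GRing.ComUnitRing_isIntegral.Build Zp padic_mulf_eq0.

End PadicInt.

Definition padic (p : nat) (p_pr : prime p) : fieldType :=
  {fraction padic_int p_pr}.

Record fps (F : fieldType) : Type := Fps { fps_coef :> nat -> F }.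

Section Fps.
Variable F : fieldType.
Local Notation S := (fps F).

HB.instance Definition _ := gen_eqMixin S.
HB.instance Definition _ := gen_choiceMixin S.

Lemma fpsP (f g : S) : (forall n, f n = g n) -> f = g.
Proof. by case: f g => [f] [g] /= /funext ->. Qed.

Definition fps_zero : S := Fps (fun=> 0).
Definition fps_one : S := Fps (fun n => (n == 0%N)%:R).
Definition fps_add (f g : S) : S := Fps (fun n => f n + g n).
Definition fps_opp (f : S) : S := Fps (fun n => - f n).
Definition fps_mul (f g : S) : S :=
  Fps (fun n => \sum_(i < n.+1) f i * g (n - i)%N).

Lemma fps_addA : associative fps_add.
Proof. by move=> f g h; apply: fpsP => n /=; rewrite addrA. Qed.
Lemma fps_addC : commutative fps_add.
Proof. by move=> f g; apply: fpsP => n /=; rewrite addrC. Qed.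
Lemma fps_add0 : left_id fps_zero fps_add.
Proof. by move=> f; apply: fpsP => n /=; rewrite add0r. Qed.
Lemma fps_addN : left_inverse fps_zero fps_opp fps_add.
Proof. by move=> f; apply: fpsP => n /=; rewrite addNr. Qed.

HB.instance Definition _ :=
  GRing.isZmodule.Build S fps_addA fps_addC fps_add0 fps_addN.

Definition fps_trunc (N : nat) (f : S) : {poly F} := \poly_(i < N) f i.

Lemma fps_mul_trunc N (f g : S) n : (n < N)%N ->
  fps_mul f g n = (fps_trunc N f * fps_trunc N g)`_n.
Proof.
move=> nN; rewrite coefM /=; apply: eq_bigr => i _.
rewrite !coef_poly (leq_ltn_trans _ nN) ?(leq_ltn_trans _ nN) ?leq_subr //.
by rewrite -ltnS.
Qed.

Lemma fps_mulA : associative fps_mul.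
Proof.
move=> f g h; apply: fpsP => n.
pose T := fps_trunc n.+1.
transitivity ((T f * (T g * T h))`_n).
  rewrite coefM; apply: eq_bigr => i _.
  rewrite coef_poly ltn_ord -fps_mul_trunc ?ltnS ?leq_subr //.
rewrite mulrA coefM; apply: eq_bigr => i _.
by rewrite coef_poly ltnS leq_subr -fps_mul_trunc.
Qed.

Lemma fps_mulC : commutative fps_mul.
Proof.
by move=> f g; apply: fpsP => n; rewrite !(@fps_mul_trunc n.+1) // mulrC.
Qed.

Lemma fps_mul1 : left_id fps_one fps_mul.
Proof.
move=> f; apply: fpsP => n /=; rewrite big_ord_recl /= subn0 mul1r.
by rewrite big1 ?addr0 // => i _; rewrite mul0r.
Qed.

Lemma fps_mulD : left_distributive fps_mul fps_add.
Proof.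
move=> f g h; apply: fpsP => n /=; rewrite -big_split /=.
by apply: eq_bigr => i _; rewrite mulrDl.
Qed.

Lemma fps_oner_neq0 : fps_one != fps_zero.
Proof.
apply/eqP => /(congr1 (fun f : S => f 0%N)) /= /eqP.
by rewrite oner_eq0.
Qed.

HB.instance Definition _ := GRing.Zmodule_isComNzRing.Build S
  fps_mulA fps_mulC fps_mul1 fps_mulD fps_oner_neq0.

HB.instance Definition _ := GRing.ComNzRing_hasMulInverse.Build S
  (@classical_mulVr S) (@classical_unitP S) (@classical_inv_out S).

Lemma fps_neq0 (f : S) : f != 0 ->
  exists2 a, f a != 0 & forall i, (i < a)%N -> f i = 0.
Proof.
move=> /eqP f0.
have ex : exists n, f n != 0.
  apply: contrapT => /forallNP h; apply: f0; apply: fpsP => n.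
  by apply/eqP; rewrite -[_ == _]negbK; apply/negP/h.
case: (ex_minnP ex) => a fa amin; exists a => // i ia; apply/eqP.
by rewrite -[_ == _]negbK; apply/negP => /amin; rewrite leqNgt ia.
Qed.

Lemma fps_mulf_eq0 (f g : S) : f * g = 0 -> (f == 0) || (g == 0).
Proof.
move=> fg0; case: eqVneq => //= /fps_neq0[a fa fm].
case: eqVneq => //= /fps_neq0[b gb gm].
have := congr1 (fun h : S => h (a + b)%N) fg0 => /= /eqP.
have ha : (a < (a + b).+1)%N by rewrite ltnS leq_addr.
rewrite (bigD1 (Ordinal ha)) //= addKn big1 ?addr0.
  by rewrite mulf_eq0 (negPf fa) (negPf gb).
move=> i ne; have {}ne : a != i :> nat by apply: contraNneq ne => e; apply/eqP/val_inj.
have [ia|] := ltnP i a; first by rewrite fm ?mul0r.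
rewrite leq_eqVlt (negPf ne) /= => ai; rewrite gm ?mulr0 //.
by rewrite ltn_subLR ?ltn_add2r // -ltnS ltn_ord.
Qed.

HB.instance Definition _ := GRing.ComUnitRing_isIntegral.Build S fps_mulf_eq0.

End Fps.

Definition laurent_series (F : fieldType) : fieldType := {fraction fps F}.

(* Non-Archimedean fields, presented by their ring of integers O. *)
Section NonArchimedean.
Variables (L : fieldType) (O : set L).

Definition int_unit : set L := [set x | O x /\ exists2 y, O y & x * y = 1].

(* O is a local ring: its maximal ideal is the set of its non-units. *)
Definition max_ideal : set L := O `\` int_unit.

Definition uniformizer (rho : L) : Prop :=
  max_ideal = [set rho * a | a in O].

(* For y != 0, the unique m such that y = rho ^ m * u with u a unit of O. *)
Definition ord (rho y : L) : int := xget 0 [set m : int | int_unit (y / rho ^ m)].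

(* The phase of y is the class modulo max_ideal of y / rho ^ ord y, so it is 1
   iff the following congruence holds. *)
Definition nonarch_phase_eq1 (rho y : L) : Prop :=
  max_ideal (y / rho ^ ord rho y - 1).

End NonArchimedean.

(* The ring of integers of L is the integral closure of Z_p in L. *)
Definition padic_ext_integers (p : nat) (p_pr : prime p)
    (L : fieldExtType (padic p_pr)) : set L :=
  [set x | integralOver
             (fun a : padic_int p_pr => (tofrac a : padic p_pr)%:A : L) x].

Definition laurent_series_integers (F : fieldType) : set (laurent_series F) :=
  range (fun a : fps F => tofrac a : laurent_series F).

(* A local field, together with the choice of a uniformizer when it is
   non-Archimedean. *)
Inductive local_field (R : realType) : Type :=
| LocalReal
| LocalComplex
| LocalPadicExt (p : nat) (p_pr : prime p) (L : fieldExtType (padic p_pr))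
    (rho : L) of uniformizer (@padic_ext_integers p p_pr L) rho
| LocalLaurentSeries (F : finFieldType) (rho : laurent_series F)
    of uniformizer (@laurent_series_integers F) rho.

Arguments LocalReal {R}.
Arguments LocalComplex {R}.
Arguments LocalPadicExt {R p p_pr L rho} _.
Arguments LocalLaurentSeries {R F rho} _.

Definition local_sort (R : realType) (K : local_field R) : fieldType :=
  match K with
  | LocalReal => R
  | LocalComplex => R[i]
  | @LocalPadicExt _ _ _ L _ _ => L
  | @LocalLaurentSeries _ F _ _ => laurent_series F
  end.

Coercion local_sort : local_field >-> fieldType.

Definition arch_phase (K : numFieldType) (y : K) : K := y / `|y|.

Definition phase_eq1 (R : realType) (K : local_field R) : K -> Prop :=
  match K return K -> Prop with
  | LocalReal => fun y : R => arch_phase y = 1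
  | LocalComplex => fun y : R[i] => arch_phase y = 1
  | @LocalPadicExt _ _ p_pr L rho _ =>
      nonarch_phase_eq1 (@padic_ext_integers _ p_pr L) rho
  | @LocalLaurentSeries _ F rho _ =>
      nonarch_phase_eq1 (@laurent_series_integers F) rho
  end.

Section Laurent.
Variables (L : fieldType) (n : nat).

(* A Laurent polynomial in n variables is its finitely supported family of
   coefficients, indexed by exponent vectors in Z^n. *)
Definition laurent : Type := {fsfun 'rV[int]_n -> L with 0}.

Definition monomial (a : 'rV[int]_n) (x : 'rV[L]_n) : L :=
  \prod_(i < n) x 0 i ^ a 0 i.

Definition laurent_eval (f : laurent) (x : 'rV[L]_n) : L :=
  \sum_(a <- finsupp f) f a * monomial a x.

(* Value at x of the formal partial derivative of f in the j-th variable,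
   which maps x^a to a_j * x^(a - e_j). *)
Definition laurent_deriv (f : laurent) (j : 'I_n) (x : 'rV[L]_n) : L :=
  \sum_(a <- finsupp f) f a * (a 0 j)%:~R * monomial (a - delta_mx 0 j) x.

Definition system : Type := 'I_n -> laurent.

Definition exponents (F : system) : {fset 'rV[int]_n} :=
  (\big[fsetU/fset0]_(i < n) finsupp (F i))%fset.

Definition jacobian (F : system) (x : 'rV[L]_n) : 'M[L]_n :=
  \matrix_(i < n, j < n) laurent_deriv (F i) j x.

Definition nondegenerate_root (F : system) (x : 'rV[L]_n) : Prop :=
  (forall i, laurent_eval (F i) x = 0) /\ \rank (jacobian F x) = n.

End Laurent.

Section Y.
Variables (R : realType) (K : local_field R).

Definition nomial_systems (n : nat) (k : int) : set (system K n) :=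
  [set F | #|` exponents F|%:Z = n%:Z + k].

Definition phase1_roots (n : nat) (F : system K n) : set 'rV[K]_n :=
  [set x | nondegenerate_root F x /\
           forall i, x 0 i != 0 /\ phase_eq1 (x 0 i)].

(* counting is +oo on infinite sets. The maximum with 0 only matters when
   there are no systems, in which case ereal_sup is -oo. *)
Definition Y (n : nat) (k : int) : \bar R :=
  maxe 0%E
    (ereal_sup [set counting (phase1_roots F) | F in @nomial_systems n k]).

End Y.

(* Main.v *)
(* Write F = C v, with C the coefficient matrix and v the column of the monomials
   occurring in F. At a root x in the torus the Jacobian factors through C and
   through the matrix of exponents, so a non-degenerate root forces rank C = n;
   since v(x) is a nonzero kernel vector of C, there are at least n+1 exponents.
   If there are exactly n+1, then ker C is a line, so two roots x, y satisfy
   v(y) = l v(x), and z = y/x satisfies z^(a_j - a_0) = 1 for all exponents a_j.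
   With B the matrix of the a_j - a_0, multiplying by the adjugate of B gives
   z_i^(det B) = 1, and non-degeneracy means that det B is nonzero in L. As the
   elements of phase 1 form a group, F has at most c_d^n roots of phase 1, with
   d = |det B| and c_d the number of d-th roots of unity of phase 1. The systems
   x_i^d = 1 attain this bound, so Y_L(n,1) is the supremum of the c_d^n over the
   d that are nonzero in L.

   It remains to find the roots of unity of phase 1. They are trivial among the
   positive reals. In the non-Archimedean case they lie in 1 + M, where a root of
   unity whose order d is a unit of O is trivial because
   1 + z + ... + z^(d-1) = d mod M. In 1 + p Z_p with p odd, p-torsion is excluded
   because that sum, for d = p, is p mod p^2; in 1 + 2 Z_2 only 1 and -1 remain
   because -1 is not a square modulo 4. *)
Require Import Defs.
From HB Require Import structures.
From mathcomp Require Import all_boot all_order all_algebra all_field finmap.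
From mathcomp Require Import all_classical all_reals all_analysis.
From mathcomp.real_closed Require Import complex.
From mathcomp Require Import ring.
Import Order.TTheory GRing.Theory Num.Theory.
Local Open Scope ring_scope.

Set Implicit Arguments.
Unset Strict Implicit.
Unset Printing Implicit Defensive.

Lemma natr_neq0_gt0 (L : fieldType) d : d%:R != 0 :> L -> (0 < d)%N.
Proof. by rewrite lt0n; apply: contraNneq => ->. Qed.

(** * Monomials as characters of the torus *)

Section Monomial.
Variables (L : fieldType) (n : nat).
Implicit Types (a b : 'rV[int]_n) (x y : 'rV[L]_n).

Definition in_torus x := forall i, x 0 i != 0.

Lemma monomial_neq0 a x : in_torus x -> monomial a x != 0.
Proof. by move=> x0; apply/prodf_neq0 => i _; rewrite expfz_neq0. Qed.

Lemma monomial0 x : monomial 0 x = 1.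
Proof. by rewrite /monomial big1 // => i _; rewrite mxE expr0z. Qed.

Lemma monomialD a b x : in_torus x ->
  monomial (a + b) x = monomial a x * monomial b x.
Proof.
move=> x0; rewrite /monomial -big_split; apply: eq_bigr => i _ /=.
by rewrite mxE expfzDr.
Qed.

Lemma monomialZ (m : int) a x : monomial (m *: a) x = monomial a x ^ m.
Proof.
rewrite /monomial (big_morph (fun u : L => u ^ m) (id1 := 1) (op1 := *%R)).
- by apply: eq_bigr => i _; rewrite mxE mulrC exprz_exp.
- by move=> u v; rewrite expfzMl.
- exact: exp1rz.
Qed.

Lemma monomialB a b x : in_torus x ->
  monomial (a - b) x = monomial a x / monomial b x.
Proof. by move=> x0; rewrite monomialD // -scaleN1r monomialZ exprN1. Qed.

Lemma monomial_delta j x : monomial (delta_mx 0 j) x = x 0 j.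
Proof.
rewrite /monomial (bigD1 j) //= mxE !eqxx expr1z big1 ?mulr1 // => i ij.
by rewrite mxE (negPf ij) andbF expr0z.
Qed.

Lemma monomial_sum (I : Type) (r : seq I) (b : I -> 'rV[int]_n) x :
  in_torus x -> monomial (\sum_(j <- r) b j) x = \prod_(j <- r) monomial (b j) x.
Proof.
move=> x0; apply: (big_morph (fun a => monomial a x)) => [a c|].
  exact: monomialD.
exact: monomial0.
Qed.

Lemma monomial_quotient a x y :
  monomial a (\row_i (y 0 i / x 0 i)) = monomial a y / monomial a x.
Proof.
rewrite /monomial -prodf_div; apply: eq_bigr => i _.
by rewrite mxE expfzMl exprz_inv invr_expz.
Qed.

End Monomial.

(** * Factorization of a system and its Jacobian through the coefficient matrix *)

Section Exponents.
Variables (L : fieldType) (n m : nat) (F : system L n).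
Hypothesis card_exponents : #|` exponents F| = m.

Definition exponent (j : 'I_m) : 'rV[int]_n := nth 0 (exponents F) j.

Definition coef_mx : 'M[L]_(n, m) := \matrix_(i, j) F i (exponent j).

Definition monomial_col (x : 'rV[L]_n) : 'cV[L]_m :=
  \col_j monomial (exponent j) x.

(** Each support is enlarged to the common exponent set, where the added coefficients vanish.
    Keeping [G] arbitrary serves both values and derivatives. *)
Lemma sum_finsupp_exponents (G : 'rV[int]_n -> L) i :
  \sum_(a <- finsupp (F i)) F i a * G a = \sum_j coef_mx i j * G (exponent j).
Proof.
have sub : (finsupp (F i) `<=` exponents F)%fset.
  by rewrite /exponents (bigD1 i) //= fsubsetUl.
rewrite (big_fset_incl _ sub) /= => [|a _ /fsfun_dflt ->]; last by rewrite mul0r.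
rewrite (big_nth 0) big_mkord [size _]card_exponents.
by apply: eq_bigr => j _; rewrite mxE.
Qed.

Lemma laurent_eval_exponents i x :
  laurent_eval (F i) x = (coef_mx *m monomial_col x) i 0.
Proof.
rewrite /laurent_eval (sum_finsupp_exponents (fun a => monomial a x)) mxE.
by apply: eq_bigr => j _; rewrite [monomial_col x _ _]mxE.
Qed.

Lemma root_coef_mx x :
  nondegenerate_root F x -> coef_mx *m monomial_col x = 0.
Proof.
by case=> F0 _; apply/colP => i; rewrite -laurent_eval_exponents F0 mxE.
Qed.

(** On the torus x^(a - e_l) = x^a / x_l, so each term of a partial derivative splits into
    coefficient, monomial, exponent entry and 1 / x_l. *)
Lemma jacobian_exponents x : in_torus x ->
  Defs.jacobian F x = coef_mx *m diag_mx (monomial_col x)^T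
    *m (\matrix_(j, l) (exponent j 0 l)%:~R) *m diag_mx (\row_l (x 0 l)^-1).
Proof.
move=> x0; apply/matrixP => i l; rewrite mul_mx_diag !mxE /laurent_deriv.
under eq_bigr do rewrite -mulrA.
rewrite (sum_finsupp_exponents (fun a => (a 0 l)%:~R * monomial (a - delta_mx 0 l) x)).
rewrite mulr_suml; apply: eq_bigr => j _; rewrite mul_mx_diag.
by rewrite monomialB // monomial_delta !mxE -!mulrA; congr (_ * _); rewrite mulrCA.
Qed.

Lemma rank_coef_mx x : in_torus x -> nondegenerate_root F x ->
  \rank coef_mx = n.
Proof.
move=> x0 [_]; rewrite jacobian_exponents // => rk.
apply/eqP; rewrite eqn_leq rank_leq_row /= -{1}rk -!mulmxA.
exact: mxrankM_maxl.
Qed.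

Lemma exponents_gt x : (0 < n)%N -> in_torus x -> nondegenerate_root F x ->
  (n < m)%N.
Proof.
move=> n_gt0 x0 Fx; have rk := rank_coef_mx x0 Fx.
have nm : (n <= m)%N by rewrite -{1}rk rank_leq_col.
(* If m = n, the coefficient matrix is square of full rank, so its kernel is trivial; but
   [monomial_col x] lies in it and has an entry, as [n > 0], and that entry is nonzero. *)
rewrite ltn_neqAle nm andbT; apply/eqP => enm.
have /eqP : (monomial_col x)^T *m coef_mx^T = 0.
  by rewrite -trmx_mul root_coef_mx // trmx0.
rewrite mulmx_free_eq0; last by rewrite /row_free mxrank_tr rk enm.
move=> /eqP/matrixP/(_ 0 (cast_ord enm (Ordinal n_gt0))); rewrite !mxE => /eqP.
by rewrite (negPf (monomial_neq0 _ x0)).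
Qed.

End Exponents.

(** * Systems with exactly n + 1 exponents *)

Section Simplex.
Variables (L : fieldType) (n : nat) (F : system L n).
Hypothesis card_exponents : #|` exponents F| = n.+1.
Let a := @exponent _ _ n.+1 F.
Let C := @coef_mx _ _ n.+1 F.
Let v := @monomial_col _ _ n.+1 F.

(** The rows are the edges of the exponent simplex at the vertex [a 0]; up to sign, the determinant
    is n! times its volume. *)
Definition edge_mx : 'M[int]_n := \matrix_(j, l) (a (lift 0 j) 0 l - a 0 0 l).

(** At a root the rows of C diag(v) sum to zero, so translating all exponents by [- a 0] leaves the
    Jacobian unchanged. The translated exponent of index 0 is zero and drops out, hence the edge
    matrix is a factor of a matrix of rank n. *)
Lemma det_edge_mx_neq0 x : in_torus x -> nondegenerate_root F x ->
  (\det edge_mx)%:~R != 0 :> L.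
Proof.
move=> x0 Fx; have Cv := root_coef_mx card_exponents Fx; case: Fx => _ rk.
rewrite -det_map_mx -unitfE -[_ \is a _]/(_ \in unitmx) -row_free_unit /row_free.
rewrite eqn_leq rank_leq_row -{1}rk (jacobian_exponents card_exponents) //.
rewrite (leq_trans (mxrankM_maxl _ _)) //.
pose B : 'M[L]_(n.+1, n) := \matrix_(j, l) (a j 0 l - a 0 0 l)%:~R.
have -> : C *m diag_mx (v x)^T *m (\matrix_(j, l) (exponent F j 0 l)%:~R) =
    C *m diag_mx (v x)^T *m B.
  apply/matrixP => i l; rewrite !mxE.
  under [RHS]eq_bigr do rewrite [B _ _]mxE intrB mulrBr.
  rewrite sumrB -mulr_suml.
  suff -> : \sum_j (C *m diag_mx (v x)^T) i j = 0.
    by rewrite mul0r subr0; apply: eq_bigr => j _; rewrite !mxE.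
  have /matrixP/(_ i 0) := Cv; rewrite !mxE => Cv0; rewrite -[RHS]Cv0.
  by apply: eq_bigr => j _; rewrite mul_mx_diag !mxE.
suff -> : C *m diag_mx (v x)^T *m B = (col' 0 (C *m diag_mx (v x)^T))
    *m map_mx (fun z => z%:~R) edge_mx by exact: mxrankM_maxr.
apply/matrixP => i l; rewrite !mxE big_ord_recl [B 0 l]mxE subrr mulr0 add0r.
by apply: eq_bigr => j _; rewrite [RHS]mulrC [LHS]mulrC !mxE.
Qed.

Lemma roots_proportional x y : in_torus x -> nondegenerate_root F x ->
  nondegenerate_root F y -> exists l : L, v y = l *: v x.
Proof.
move=> x0 Fx Fy; have rk := rank_coef_mx card_exponents x0 Fx.
have sub z : nondegenerate_root F z -> ((v z)^T <= kermx C^T)%MS.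
  by move=> Fz; apply/sub_kermxP; rewrite -trmx_mul root_coef_mx // trmx0.
have rv : \rank (v x)^T = 1%N.
  rewrite rank_rV; case: eqP => // /matrixP/(_ 0 0); rewrite !mxE => /eqP.
  by rewrite (negPf (monomial_neq0 _ x0)).
have rker : \rank (kermx C^T) = 1%N by rewrite mxrank_ker mxrank_tr rk subSnn.
have := mxrank_leqif_sup (sub x Fx); rewrite rv rker => -[_ /esym ker_le].
have /submxP[D vy] := submx_trans (sub y Fy) ker_le.
exists (D 0 0); apply: trmx_inj; rewrite vy [D]mx11_scalar mul_scalar_mx.
by rewrite linearZ /= !mxE.
Qed.

Lemma root_quotient_det x y i : in_torus x -> in_torus y ->
  nondegenerate_root F x -> nondegenerate_root F y ->
  (y 0 i / x 0 i) ^ (\det edge_mx) = 1.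
Proof.
move=> x0 y0 Fx Fy; have [l vy] := roots_proportional x0 Fx Fy.
pose z : 'rV[L]_n := \row_i (y 0 i / x 0 i).
have z0 : in_torus z by move=> j; rewrite mxE mulf_neq0 ?invr_eq0.
(* Proportionality of the monomial vectors says that all exponents take the same value at the
   quotient z, so their differences take the value 1. *)
have za j : monomial (a j) z = l.
  have /colP/(_ j) := vy; rewrite !mxE => ey.
  by rewrite monomial_quotient ey mulfK ?monomial_neq0.
have l0 : l != 0 by rewrite -(za 0) monomial_neq0.
have zB j : monomial (row j edge_mx) z = 1.
  have -> : row j edge_mx = a (lift 0 j) - a 0 by apply/rowP => k; rewrite !mxE.
  by rewrite monomialB // !za divff.
have -> : y 0 i / x 0 i = monomial (delta_mx 0 i) z by rewrite monomial_delta mxE.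
rewrite -monomialZ.
(* The adjugate writes det B times a basis vector as an integral combination of the rows of B. *)
have -> : \det edge_mx *: delta_mx 0 i = \sum_j \adj edge_mx i j *: row j edge_mx.
  transitivity (row i (\adj edge_mx *m edge_mx)).
    by rewrite mul_adj_mx; apply/rowP => k; rewrite !mxE eq_sym mulr_natr.
  by rewrite row_mul mulmx_sum_row; apply: eq_bigr => j _; rewrite mxE.
rewrite monomial_sum // big1 // => j _.
by rewrite monomialZ zB exp1rz.
Qed.

End Simplex.

(** * The extremal systems [x_i ^+ d - 1] *)

Section Binomial.
Variables (L : fieldType) (n d : nat).
Hypothesis d_neq0 : d%:R != 0 :> L.

Let d_gt0 : (0 < d)%N := natr_neq0_gt0 d_neq0.

Let e (i : 'I_n) : 'rV[int]_n := d%:Z *: delta_mx 0 i.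

Let e_neq0 i : e i != 0.
Proof.
apply/eqP => /rowP/(_ i); rewrite !mxE !eqxx mulr1 => -[d0].
by move: d_gt0; rewrite d0.
Qed.

Let e_inj : injective e.
Proof.
move=> i j /rowP/(_ i); rewrite !mxE !eqxx mulr1 /=.
by case: eqVneq => // _; rewrite mulr0 => -[d0]; move: d_gt0; rewrite d0.
Qed.

Definition power_system : system L n := fun i =>
  [fsfun a in [fset 0; e i]%fset => (if a == 0 then -1 else 1) | 0].

Lemma finsupp_power_system i :
  finsupp (power_system i) = [fset 0; e i]%fset.
Proof.
rewrite finsupp_fsfun; apply/fsetP => a; rewrite !inE andb_idr // => _.
by case: ifP; rewrite ?oppr_eq0 oner_eq0.
Qed.

Lemma sum_power_system i (G : 'rV[int]_n -> L) :
  \sum_(a <- finsupp (power_system i)) power_system i a * G a = G (e i) - G 0.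
Proof.
rewrite finsupp_power_system big_fsetU1 ?inE 1?eq_sym //= big_seq_fset1.
rewrite !fsfun_fun !inE !eqxx orbT (negPf (e_neq0 i)).
by rewrite mul1r mulN1r addrC.
Qed.

Lemma power_system_eval i x : laurent_eval (power_system i) x = x 0 i ^+ d - 1.
Proof.
rewrite /laurent_eval (sum_power_system i (fun a => monomial a x)).
by rewrite monomial0 monomialZ monomial_delta.
Qed.

Lemma power_system_deriv i j x : in_torus x ->
  laurent_deriv (power_system i) j x =
  if i == j then d%:R * x 0 i ^+ d / x 0 i else 0.
Proof.
move=> x0; rewrite /laurent_deriv; under eq_bigr do rewrite -mulrA.
rewrite (sum_power_system i
  (fun a => (a 0 j)%:~R * monomial (a - delta_mx 0 j) x)).
rewrite !mxE mul0r subr0 eqxx /= [j == i]eq_sym.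
case: eqVneq => [<-|_]; last by rewrite mulr0 mul0r.
by rewrite mulr1 monomialB // monomialZ !monomial_delta mulrA.
Qed.

(** At a solution the Jacobian is diagonal with entries d / x_i, which are nonzero because d is
    nonzero in L. *)
Lemma power_system_nondegenerate x : in_torus x ->
  nondegenerate_root power_system x <-> forall i, x 0 i ^+ d = 1.
Proof.
move=> x0; split=> [[Fx _] i|xd].
  by have /eqP := Fx i; rewrite power_system_eval subr_eq0 => /eqP.
split=> [i|]; first by rewrite power_system_eval xd subrr.
apply/eqP; rewrite -/(row_free _) row_free_unit unitmxE unitfE.
have -> : Defs.jacobian power_system x = diag_mx (\row_i (d%:R / x 0 i)).
  apply/matrixP => i j; rewrite !mxE power_system_deriv // xd mulr1.
  by case: eqP => // ->.
rewrite det_diag; apply/prodf_neq0 => i _.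
by rewrite mxE mulf_neq0 ?invr_eq0.
Qed.

(** The n equations share the exponent 0, which occurs because there is at least one equation; the
    [e i] add n more. *)
Lemma card_exponents_power_system :
  (0 < n)%N -> #|` exponents power_system| = n.+1.
Proof.
move=> n_gt0.
have -> : exponents power_system =
    (0 |` [fset e i | i in 'I_n])%fset.
  apply/fsetP => a; rewrite !inE; apply/bigfcupP/orP => [[i _]|].
    rewrite finsupp_power_system !inE => /orP[->|/eqP->]; first by left.
    by right; apply: in_imfset.
  case=> [/eqP->|/imfsetP[i _ ->]].
    exists (Ordinal n_gt0); rewrite ?mem_index_enum //.
    by rewrite finsupp_power_system !inE eqxx.
  exists i; rewrite ?mem_index_enum // finsupp_power_system.
  by rewrite !inE eqxx orbT.
rewrite cardfsU1 card_imfset //= size_enum_ord.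
case: imfsetP => [[i _ /esym/eqP]|//].
by rewrite (negPf (e_neq0 i)).
Qed.

End Binomial.

(** * Counting measure of finitely parametrized sets *)

Section Counting.
Variables (R : realType) (T : choiceType) (U : finType) (g : U -> T).

Let range_finite : finite_set (range g).
Proof. exact: finite_image. Qed.

Let fset_set_range : fset_set (range g) = [fset g u | u in U]%fset.
Proof.
apply/fsetP => x; rewrite in_fset_set //; apply/idP/imfsetP => [|[u _ ->]].
  by rewrite inE => -[u _ <-]; exists u.
by rewrite inE; exists u.
Qed.

Lemma counting_le_card (A : set T) : (A `<=` range g)%classic ->
  (counting A <= #|U|%:R%:E :> \bar R)%E.
Proof.
move=> Ag; have Afin : finite_set A by exact: sub_finite_set range_finite.
rewrite /counting (asboolT Afin) lee_fin ler_nat.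
move: Ag; rewrite fset_set_sub // => /fsubset_leq_card /leq_trans; apply.
by rewrite fset_set_range cardE leq_imfset_card.
Qed.

Lemma counting_range : injective g ->
  counting (range g) = #|U|%:R%:E :> \bar R.
Proof.
move=> g_inj; rewrite /counting (asboolT range_finite) fset_set_range.
by rewrite card_imfset //= -cardE.
Qed.

End Counting.

(** * Y in terms of the roots of unity of phase 1 *)

Section PhaseOneUnity.
Variables (R : realType) (K : local_field R).

Definition phase1 (z : K) : Prop := z != 0 /\ phase_eq1 z.

(** [fset_set] sends infinite sets to the empty one, so this has its intended meaning only once
    finiteness is known, as it is for [d > 0]. *)
Definition phase1_unity (d : nat) : {fset K} :=
  fset_set [set z | phase1 z /\ z ^+ d = 1]%classic.

Lemma phase1_unityP d z : (0 < d)%N ->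
  (z \in phase1_unity d) <-> (phase1 z /\ z ^+ d = 1).
Proof.
move=> d_gt0; rewrite in_fset_set ?inE //.
(* An infinite set would contain d + 1 distinct roots of X^d - 1. *)
apply: contrapT => /(@infinite_set_fset _ _ d.+1)[B BA]; apply/negP; rewrite -ltnNge ltnS.
have pd : 'X^d - 1 != 0 :> {poly K} by rewrite -size_poly_eq0 size_XnsubC.
have Br : all (root ('X^d - 1)) B.
  apply/allP => w /BA[_ wd].
  by rewrite /root !hornerE wd subrr.
by have := max_poly_roots pd Br (fset_uniq B); rewrite size_XnsubC.
Qed.

(** A root of phase 1 lies in the torus, so [exponents_gt] would give n < n + k. Hence every counted
    set is empty, and the maximum with 0 covers the absence of systems. *)
Lemma Y_le0 n (k : int) : (1 <= n)%N -> k <= 0 -> Y K n k = 0%E.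
Proof.
move=> n_gt0 k_le0; rewrite /Y; apply/max_idPl; apply: ge_ereal_sup.
move=> _ [F Fnk <-].
have -> : phase1_roots F = set0; last by rewrite /counting asboolT ?fset_set0 ?cardfs0.
apply/seteqP; split=> // x [Fx x1].
have /(exponents_gt erefl n_gt0)/(_ Fx) : in_torus x by move=> i; have [] := x1 i.
by rewrite -ltz_nat Fnk ltrDl ltNge k_le0.
Qed.

Hypothesis phase1_mul : forall x y, phase1 x -> phase1 y -> phase1 (x * y).
Hypothesis phase1_inv : forall x, phase1 x -> phase1 x^-1.

Let exp_absz (z : K) (m : int) : z ^ m = 1 -> z ^+ `|m|%N = 1.
Proof.
case: m => // m; rewrite NegzE -invr_expz => /eqP.
by rewrite invr_eq1 => /eqP.
Qed.

Let natr_absz_neq0 (m : int) : m%:~R != 0 :> K -> `|m|%N%:R != 0 :> K.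
Proof. by case: m => // m; rewrite NegzE mulrNz oppr_eq0. Qed.

Lemma counting_phase1_roots_le n F : @nomial_systems R K n 1 F ->
  exists2 d : nat, d%:R != 0 :> K &
  (counting (phase1_roots F) <= (#|` phase1_unity d| ^ n)%N%:R%:E :> \bar R)%E.
Proof.
move=> nF; have {}nF : #|` exponents F| = n.+1.
  by move: nF; rewrite /nomial_systems /= -PoszD addn1 => -[].
have [->|/set0P[x [Fx x1]]] := eqVneq (phase1_roots F) set0.
  (* Without roots any d nonzero in K will do. *)
  exists 1%N; first exact: oner_neq0.
  by rewrite /counting asboolT // fset_set0 cardfs0 lee_fin ler0n.
have tor (y : 'rV[K]_n) : (forall i, phase1 (y 0 i)) -> in_torus y.
  by move=> y1 i; have [] := y1 i.
have x0 := tor _ x1.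
have dn0 := natr_absz_neq0 (det_edge_mx_neq0 nF x0 Fx).
exists `|\det (edge_mx F)|%N => //; set d := absz _ in dn0 *.
pose U : finType := {ffun 'I_n -> phase1_unity d}.
(* All roots are recovered from one root x by multiplying its coordinates by roots of unity of phase
   1. *)
pose g (f : U) := \row_i (x 0 i * val (f i)).
rewrite [X in (X%:R%:E)%E](_ : _ = #|U|); last first.
  by rewrite card_ffun card_ord cardfE.
apply: (counting_le_card R (g := g)) => y [Fy y1].
have mem i : y 0 i / x 0 i \in phase1_unity d.
  apply/phase1_unityP; first exact: natr_neq0_gt0 dn0.
  split; first by apply: phase1_mul (y1 i) (phase1_inv (x1 i)).
  by apply: exp_absz; apply: root_quotient_det => //; exact: tor.
exists [ffun i => [` mem i]%fset] => //; apply/rowP => i.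
by rewrite mxE ffunE /= mulrC divfK.
Qed.

Lemma counting_power_system n d : d%:R != 0 :> K ->
  counting (phase1_roots (@power_system K n d)) =
  (#|` phase1_unity d| ^ n)%N%:R%:E :> \bar R.
Proof.
move=> dn0; have d_gt0 := natr_neq0_gt0 dn0.
pose U : finType := {ffun 'I_n -> phase1_unity d}.
pose g (f : U) : 'rV[K]_n := \row_i val (f i).
rewrite [X in (X%:R%:E)%E](_ : _ = #|U|); last first.
  by rewrite card_ffun card_ord cardfE.
rewrite -(@counting_range R _ _ g); last first.
  move=> f1 f2 /rowP e; apply/ffunP => i; apply: val_inj.
  by have := e i; rewrite !mxE.
congr counting; apply/seteqP; split=> [x [Fx x1]|_ [f _ <-]].
  have x0 : in_torus x by move=> i; have [] := x1 i.
  have /(power_system_nondegenerate dn0 x0) xd := Fx.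
  have mem i : x 0 i \in phase1_unity d by apply/phase1_unityP => //; split.
  by exists [ffun i => [` mem i]%fset] => //; apply/rowP => i; rewrite mxE ffunE.
have f1 i : phase1 (g f 0 i) /\ g f 0 i ^+ d = 1.
  by rewrite mxE; apply/phase1_unityP => //; exact: valP.
split; last by move=> i; have [] := f1 i.
apply/power_system_nondegenerate => // i; first by have [[]] := f1 i.
by have [] := f1 i.
Qed.

Lemma power_system_nomial n d : (0 < n)%N -> d%:R != 0 :> K ->
  @nomial_systems R K n 1 (@power_system K n d).
Proof.
move=> n_gt0 dn0.
by rewrite /nomial_systems /= card_exponents_power_system // -PoszD addn1.
Qed.

Lemma Y_max n N : (0 < n)%N ->
  (forall d, d%:R != 0 :> K -> (#|` phase1_unity d| <= N)%N) ->
  (exists2 d, d%:R != 0 :> K & #|` phase1_unity d| = N) ->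
  Y K n 1 = (N ^ n)%N%:R%:E.
Proof.
move=> n_gt0 leN [d dn0 dN].
rewrite /Y; suff -> : ereal_sup [set counting (phase1_roots F) |
    F in @nomial_systems R K n 1]%classic = (N ^ n)%N%:R%:E :> \bar R.
  by apply/max_idPr; rewrite lee_fin ler0n.
apply/eqP; rewrite eq_le; apply/andP; split.
  apply: ge_ereal_sup => _ [F nF <-].
  have [e en0 le_e] := counting_phase1_roots_le nF.
  by rewrite (le_trans le_e) // lee_fin ler_nat leq_exp2r // leN.
apply: ereal_sup_ubound; exists (@power_system K n d).
  exact: power_system_nomial.
by rewrite counting_power_system // dN.
Qed.

(** [Y_exp] distinguishes whether the numbers c_d are bounded; this is the unbounded case, where
    both of its sides are infinite. *)
Lemma Y_unbounded n : (0 < n)%N ->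
  (forall N, exists2 d, d%:R != 0 :> K & (N < #|` phase1_unity d|)%N) ->
  Y K n 1 = +oo%E.
Proof.
move=> n_gt0 ub; apply/eqyP => A A_gt0.
have [d dn0 dA] := ub (Num.trunc A).
apply: (@le_trans _ _ (#|` phase1_unity d| ^ n)%N%:R%:E).
  rewrite lee_fin ltW // (lt_le_trans (truncnS_gt A)) // ler_nat.
  rewrite (leq_trans dA) // -{1}[#|` _|]expn1.
  by rewrite leq_pexp2l // (leq_ltn_trans _ dA).
rewrite /Y le_max; apply/orP; right.
apply: ereal_sup_ubound; exists (@power_system K n d).
  exact: power_system_nomial.
exact: counting_power_system.
Qed.

Lemma Y_exp n : (0 < n)%N -> Y K n 1 = (Y K 1 1 ^+ n)%E.
Proof.
move=> n_gt0.
have [ub|/existsNP[N0 bd]] := pselect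
    (forall N, exists2 d, d%:R != 0 :> K & (N < #|` phase1_unity d|)%N).
  rewrite !Y_unbounded //; case: n n_gt0 => // n _.
  elim: n => [//|n IHn]; rewrite expeS -IHn mulyy //.
(* Bounded numbers c_d have an attained maximum N, and [Y_max] gives N^n and N^1. *)
pose P N := `[< exists2 d, d%:R != 0 :> K & #|` phase1_unity d| = N >].
have exP : exists N, P N.
  by exists #|` phase1_unity 1|; apply/asboolP; exists 1%N => //; exact: oner_neq0.
have leN N : P N -> (N <= N0)%N.
  move=> /asboolP[d dn0 <-]; rewrite leqNgt; apply/negP => lt.
  by apply: bd; exists d.
case: (ex_maxnP exP leN) => N /asboolP exN maxN.
have le d : d%:R != 0 :> K -> (#|` phase1_unity d| <= N)%N.
  by move=> dn0; apply: maxN; apply/asboolP; exists d.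
rewrite (Y_max n_gt0 le exN) (Y_max (ltn0Sn 0) le exN) expn1.
by rewrite natrX EFin_expe.
Qed.

End PhaseOneUnity.

(** * Phase and torsion over a ring with principal maximal ideal *)

Section UniformizerPhase.
Variables (L : fieldType) (O : set L) (rho : L).
Hypothesis O1 : O 1.
Hypothesis OB : forall x y, O x -> O y -> O (x - y).
Hypothesis OM : forall x y, O x -> O y -> O (x * y).
Hypothesis rho_unif : uniformizer O rho.

Local Notation M := (max_ideal O).
Local Notation unit := (int_unit O).

Let O0 : O 0. Proof. by rewrite -(subrr 1); apply: OB. Qed.
Let ON x : O x -> O (- x). Proof. by rewrite -sub0r; apply: OB. Qed.
Let OD x y : O x -> O y -> O (x + y).
Proof. by move=> Ox /ON Oy; rewrite -[y]opprK; apply: OB. Qed.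
Let OX x n : O x -> O (x ^+ n).
Proof. by move=> Ox; elim: n => // n IH; rewrite exprS; apply: OM. Qed.

(** Being of the form rho O makes the non-units closed under subtraction, so O is local. *)
Let ME x : M x <-> exists2 a, O a & rho * a = x.
Proof. by rewrite rho_unif. Qed.

Let MO x : M x -> O x. Proof. by case. Qed.

Let MB x y : M x -> M y -> M (x - y).
Proof.
move=> /ME[a Oa <-] /ME[b Ob <-]; apply/ME; exists (a - b); first exact: OB.
by rewrite mulrBr.
Qed.

Let M0 : M 0. Proof. by apply/ME; exists 0; rewrite ?mulr0. Qed.

Let MN x : M x -> M (- x). Proof. by rewrite -sub0r; apply: MB. Qed.

Let MD x y : M x -> M y -> M (x + y).
Proof. by move=> Mx /MN My; rewrite -[y]opprK; apply: MB. Qed.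

Let MM x y : M x -> O y -> M (x * y).
Proof.
move=> /ME[a Oa <-] Oy; apply/ME; exists (a * y); first exact: OM.
by rewrite mulrA.
Qed.

Let unitM x y : unit x -> unit y -> unit (x * y).
Proof.
move=> [Ox [a Oa xa]] [Oy [b Ob yb]]; split; first exact: OM.
by exists (a * b); [exact: OM|rewrite mulrACA xa yb mulr1].
Qed.

Let unit1 : unit 1. Proof. by split=> //; exists 1; rewrite ?mulr1. Qed.

Let unitX x n : unit x -> unit (x ^+ n).
Proof. by move=> ux; elim: n => // n IH; rewrite exprS; apply: unitM. Qed.

Let unitV x : unit x -> unit x^-1.
Proof.
move=> [Ox [a Oa xa]]; have <- : a = x^-1; last by split=> //; exists x; rewrite // mulrC.
have x0 : x != 0 by apply: contra_eq_neq xa => ->; rewrite mul0r eq_sym oner_eq0.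
by apply: (mulfI x0); rewrite xa divff.
Qed.

Let unit_neq0 x : unit x -> x != 0.
Proof.
by move=> [_ [y _ xy]]; apply: contra_eq_neq xy => ->; rewrite mul0r eq_sym oner_eq0.
Qed.

Lemma max_ideal_not_unit x : M x -> ~ unit x. Proof. by case. Qed.

(** Otherwise x would be in M, and so would 1 = x - (x - 1). *)
Lemma one_units x : M (x - 1) -> unit x.
Proof.
move=> Mx; apply: contrapT => Nx.
have {Nx}Mx' : M x by split=> //; rewrite -[x](subrK 1); apply: OD => //; case: Mx.
by have [_] := MB Mx' Mx; rewrite opprB addrC subrK.
Qed.

Let unit_rho_exp (k : int) : unit (rho ^ k) -> k = 0.
Proof.
have N (n : nat) : ~ unit (rho ^+ n.+1).
  apply: max_ideal_not_unit; apply/ME; exists (rho ^+ n); last by rewrite exprS.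
  by apply: OX; apply: MO; apply/ME; exists 1; rewrite ?mulr1.
case: k => [[//|n] /N//|n]; rewrite NegzE -invr_expz => /unitV.
by rewrite invrK => /N.
Qed.

(** A uniformizer is 0 when O is a field. Then [rho ^ m] and its inverse are 0 for every nonzero m,
    so only m = 0 can give a unit. *)
Let rho0_exp y (m : int) : rho = 0 -> unit (y / rho ^ m) -> m = 0.
Proof.
move=> -> /unit_neq0; have [//|m0] := eqVneq m 0.
by rewrite exp0rz (negPf m0) invr0 mulr0 eqxx.
Qed.

(** Replaces the chosen [ord] by any exponent, which suits products and inverses. If two exponents
    both turn y into a unit, then [rho] to their difference is a unit, so they agree. *)
Lemma nonarch_phaseP y :
  nonarch_phase_eq1 O rho y <-> exists m : int, M (y / rho ^ m - 1).
Proof.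
split=> [My|[m My]]; first by exists (ord O rho y).
rewrite /nonarch_phase_eq1.
have um := one_units My.
suff -> : ord O rho y = m by [].
rewrite /ord; case: xgetP => [m' _ /= um'|/(_ m) //].
have [rho0|rho_neq0] := eqVneq rho 0.
  by rewrite (rho0_exp rho0 um) (rho0_exp rho0 um').
apply/esym/eqP; rewrite -subr_eq0; apply/eqP/unit_rho_exp.
have -> : rho ^ (m - m') = (y / rho ^ m') * (y / rho ^ m)^-1.
  have y0 : y != 0 by have := unit_neq0 um; apply: contraNneq => ->; rewrite mul0r.
  by rewrite expfzDr // -invr_expz invfM invrK mulrACA divff // mul1r mulrC.
by apply: unitM => //; exact: unitV.
Qed.

Lemma nonarch_phase1 : nonarch_phase_eq1 O rho 1.
Proof. by apply/nonarch_phaseP; exists 0; rewrite divr1 subrr. Qed.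

Lemma nonarch_phaseM x y : nonarch_phase_eq1 O rho x ->
  nonarch_phase_eq1 O rho y -> nonarch_phase_eq1 O rho (x * y).
Proof.
move=> /nonarch_phaseP[m Mx] /nonarch_phaseP[k My]; apply/nonarch_phaseP.
exists (m + k).
have -> : x * y / rho ^ (m + k) = (x / rho ^ m) * (y / rho ^ k).
  rewrite mulrACA -invfM; have [rho0|rho_neq0] := eqVneq rho 0.
    rewrite (rho0_exp rho0 (one_units Mx)) (rho0_exp rho0 (one_units My)).
    by rewrite addr0 expr0z mulr1.
  by rewrite expfzDr.
set u := _ / _; set v := _ / _.
have -> : u * v - 1 = (u - 1) * v + (v - 1) by rewrite mulrBl mul1r addrA subrK.
by apply: MD => //; apply: MM => //; case: (one_units My).
Qed.

Lemma nonarch_phaseV x : nonarch_phase_eq1 O rho x ->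
  nonarch_phase_eq1 O rho x^-1.
Proof.
move=> /nonarch_phaseP[m Mx]; apply/nonarch_phaseP; exists (- m).
rewrite -invr_expz -invfM; have := one_units Mx; move: Mx; set u := _ / _.
move=> Mu uu.
have -> : u^-1 - 1 = - (u - 1) * u^-1.
  by rewrite mulNr mulrBl divff ?unit_neq0 // mul1r opprB.
by apply: MM; [exact: MN|case: (unitV uu)].
Qed.

(** The d-th power of the unit z / rho^m is rho^(- m d), which forces m d = 0. *)
Lemma nonarch_phase_torsion z d : (0 < d)%N -> nonarch_phase_eq1 O rho z ->
  z ^+ d = 1 -> M (z - 1).
Proof.
move=> d_gt0 /nonarch_phaseP[m Mz] zd; suff m0 : m = 0.
  by move: Mz; rewrite m0 expr0z divr1.
have := unitX d (one_units Mz); rewrite expr_div_n zd mul1r => /unitV.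
rewrite invrK exprnP exprz_exp => /unit_rho_exp/eqP.
by rewrite mulf_eq0 => /orP[/eqP|/eqP[d0]] //; rewrite d0 in d_gt0.
Qed.

Lemma max_ideal_expB1 z i : M (z - 1) -> M (z ^+ i - 1).
Proof.
move=> Mz; elim: i => [|i IH]; first by rewrite subrr.
have -> : z ^+ i.+1 - 1 = (z ^+ i - 1) * z + (z - 1).
  by rewrite exprSr mulrBl mul1r addrA subrK.
by apply: MD => //; apply: MM => //; case: (one_units Mz).
Qed.

Lemma one_units_unit_torsion z d : unit d%:R -> M (z - 1) -> z ^+ d = 1 ->
  z = 1.
Proof.
move=> ud Mz /eqP; rewrite -subr_eq0 subrX1 mulf_eq0 subr_eq0.
case/orP=> /eqP // s0; suff /max_ideal_not_unit : M d%:R by [].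
rewrite -[d%:R]opprK; apply: MN; rewrite -[- _]add0r -s0.
have -> : d%:R = \sum_(i < d) 1 :> L by rewrite sumr_const card_ord.
rewrite -sumrB; apply: (big_ind M) => // i _.
exact: max_ideal_expB1.
Qed.

End UniformizerPhase.

(** * Closure properties of the rings of integers *)

Section PadicExtIntegers.
Variables (p : nat) (p_pr : prime p) (L : fieldExtType (padic p_pr)).
Local Notation O := (@padic_ext_integers p p_pr L).
(** The structure map as a ring morphism, convertible to the function in [padic_ext_integers], so
    that the closure lemmas for integral elements apply. *)
Let emb : {rmorphism padic_int p_pr -> L} := in_alg L \o @tofrac (padic_int p_pr).

Lemma padic_ext_integers1 : O 1.
Proof. exact: (integral1 emb). Qed.

Lemma padic_ext_integersB x y : O x -> O y -> O (x - y).
Proof. exact: (@integral_sub _ _ emb). Qed.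

Lemma padic_ext_integersM x y : O x -> O y -> O (x * y).
Proof. exact: (@integral_mul _ _ emb). Qed.

End PadicExtIntegers.

Section LaurentSeriesIntegers.
Variable F : fieldType.
Local Notation O := (@laurent_series_integers F).

Lemma laurent_series_integers1 : O 1.
Proof. by exists 1 => //; rewrite tofrac1. Qed.

Lemma laurent_series_integersB x y : O x -> O y -> O (x - y).
Proof. by move=> [a _ <-] [b _ <-]; exists (a - b); rewrite // tofracB. Qed.

Lemma laurent_series_integersM x y : O x -> O y -> O (x * y).
Proof. by move=> [a _ <-] [b _ <-]; exists (a * b); rewrite // tofracM. Qed.

End LaurentSeriesIntegers.

(** In [R[i]] the relation [0 < z] says that z is a positive real, so one criterion serves both
    Archimedean fields. *)
Lemma arch_phase_eq1 (K : numFieldType) (z : K) :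
  z != 0 -> arch_phase z = 1 <-> 0 < z.
Proof.
move=> z0; have n0 : `|z| != 0 by rewrite normr_eq0.
split=> [/divr1_eq->|z_gt0]; first by rewrite normr_gt0.
by rewrite /arch_phase gtr0_norm // divff.
Qed.

(** * The group of elements of phase 1 *)

Section Phase1Group.
Variables (R : realType) (K : local_field R).

Lemma phase1_1 : phase1 (1 : K).
Proof.
split; first exact: oner_neq0.
case: K => [||p p_pr L rho hr|F rho hr] /=.
- exact/arch_phase_eq1/ltr01/oner_neq0.
- exact/arch_phase_eq1/ltr01/oner_neq0.
- apply: nonarch_phase1 hr.
  + exact: padic_ext_integers1.
  + exact: padic_ext_integersB.
  + exact: padic_ext_integersM.
- apply: nonarch_phase1 hr.
  + exact: laurent_series_integers1.
  + exact: laurent_series_integersB.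
  + exact: laurent_series_integersM.
Qed.

Lemma phase1M (x y : K) : phase1 x -> phase1 y -> phase1 (x * y).
Proof.
move=> [x0 x1] [y0 y1]; split; first by rewrite mulf_neq0.
case: K x y x0 y0 x1 y1 => [||p p_pr L rho hr|F rho hr] /= x y x0 y0.
- move=> /(arch_phase_eq1 x0) x1 /(arch_phase_eq1 y0) y1.
  by apply/arch_phase_eq1; [rewrite mulf_neq0|rewrite mulr_gt0].
- move=> /(arch_phase_eq1 x0) x1 /(arch_phase_eq1 y0) y1.
  by apply/arch_phase_eq1; [rewrite mulf_neq0|rewrite mulr_gt0].
- apply: nonarch_phaseM hr _ _.
  + exact: padic_ext_integers1.
  + exact: padic_ext_integersB.
  + exact: padic_ext_integersM.
- apply: nonarch_phaseM hr _ _.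
  + exact: laurent_series_integers1.
  + exact: laurent_series_integersB.
  + exact: laurent_series_integersM.
Qed.

Lemma phase1V (x : K) : phase1 x -> phase1 x^-1.
Proof.
move=> [x0 x1]; split; first by rewrite invr_eq0.
case: K x x0 x1 => [||p p_pr L rho hr|F rho hr] /= x x0.
- move=> /(arch_phase_eq1 x0) x1.
  by apply/arch_phase_eq1; rewrite ?invr_eq0 ?invr_gt0.
- move=> /(arch_phase_eq1 x0) x1.
  by apply/arch_phase_eq1; rewrite ?invr_eq0 ?invr_gt0.
- apply: nonarch_phaseV hr _.
  + exact: padic_ext_integers1.
  + exact: padic_ext_integersB.
  + exact: padic_ext_integersM.
- apply: nonarch_phaseV hr _.
  + exact: laurent_series_integers1.
  + exact: laurent_series_integersB.
  + exact: laurent_series_integersM.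
Qed.

End Phase1Group.

(** * Arithmetic of Z_p and torsion in 1 + p Z_p *)

Lemma fraction_numden (A : idomainType) (x : {fraction A}) :
  exists a b : A, b != 0 /\ x * tofrac b = tofrac a.
Proof.
elim/quotW: x => x; exists x.1, x.2; split; first exact: denom_ratioP.
unlock tofrac; rewrite -[LHS]FracField.pi_mul /FracField.mulf.
apply/eqmodP; rewrite /= FracField.equivfE.
have d0 := denom_ratioP x.
by rewrite !numden_Ratio ?oner_eq0 ?mulr1 //= mulrC.
Qed.

(** For y divisible by p this gives the geometric sum modulo p^2, the precision used to exclude
    p-torsion. *)
Lemma sum_exp1D (A : comNzRingType) (y : A) n : exists r,
  \sum_(i < n) (1 + y) ^+ i = n%:R + y *+ 'C(n, 2) + y ^+ 2 * r.
Proof.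
have exp1D i : exists r, (1 + y) ^+ i = 1 + y *+ i + y ^+ 2 * r.
  elim: i => [|i [r IH]]; first by exists 0; rewrite mulr0 !addr0.
  by exists (i%:R + r * (1 + y)); rewrite exprSr IH; ring.
elim: n => [|n [r IH]].
  by exists 0; rewrite big_ord0 bin0n mulr0 !addr0.
have [r' r'E] := exp1D n; exists (r + r').
by rewrite big_ord_recr /= IH r'E binS bin1; ring.
Qed.

Section PadicIntegers.
Variables (p : nat) (p_pr : prime p).
Local Notation Zp := (padic_int p_pr).
Implicit Types x y w s t : Zp.

Lemma padic_natr_res (m n : nat) : (m%:R : Zp) n = (m %% p ^ n)%N.
Proof.
elim: m => [|m IH] //.
by rewrite mulrS /= IH modnDm.
Qed.

Lemma padic_mul_res x y n : (x * y) n = (x n * y n %% p ^ n)%N.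
Proof. by []. Qed.

Lemma padic_res1 x n : x n.+1 = x 1%N %[mod p].
Proof. by rewrite -(padic_resD x 1 n) expn1 modn_mod. Qed.

(** By Euler, x^(phi(p^n) - 1) inverts x modulo p^n; these inverses are coherent because inverses
    are unique. *)
Lemma padic_unit x : x 1%N != 0%N -> exists y, y * x = 1.
Proof.
move=> x1.
have cop n : coprime (x n) (p ^ n).
  case: n => [|n]; first by rewrite coprimen1.
  rewrite coprimeXr // coprime_sym prime_coprime // /dvdn padic_res1.
  by rewrite -[p in (_ %% p)%N]expn1 padic_res_small.
pose u n := (x n ^ (totient (p ^ n)).-1)%N.
have uE n : u n * x n = 1 %[mod p ^ n].
  rewrite -expnSr prednK ?totient_gt0 ?padic_expn_gt0 //.
  exact: cyclic.Euler_exp_totient.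
have coh n : u n = u n.+1 %[mod p ^ n].
  have uE' : u n.+1 * x n = 1 %[mod p ^ n].
    have := congr1 (modn^~ (p ^ n)%N) (uE n.+1).
    rewrite /= !modn_dvdm ?dvdn_expS // => <-.
    by rewrite -modnMmr -[in RHS]modnMmr -padic_step.
  rewrite -[u n]muln1 -modnMmr -uE' modnMmr mulnCA -modnMmr uE modnMmr.
  by rewrite muln1.
exists (padic_mk p_pr coh); apply: padic_intP => n.
by rewrite padic_mul_res /= modnMml uE.
Qed.

(** Division by p loses one digit, so the quotient modulo p^n is read off from x modulo p^(n +
    1). *)
Lemma padic_dvdp x : x 1%N = 0%N -> exists y, x = p%:R * y.
Proof.
move=> x1.
have dv n : (p %| x n.+1)%N by rewrite /dvdn padic_res1 x1 mod0n.
have coh n : (x n.+1 %/ p = x n.+2 %/ p %[mod p ^ n])%N.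
  rewrite [x n.+1]padic_coherent expnSr -modn_divl.
  by rewrite modn_mod.
exists (padic_mk p_pr coh); apply: padic_intP => n.
rewrite padic_mul_res padic_natr_res /= modnMm mulnC divnK //.
by rewrite -padic_coherent.
Qed.

Lemma padic_p_neq0 : p%:R != 0 :> Zp.
Proof.
apply/eqP => /(congr1 (fun x : Zp => x 2)).
rewrite padic_natr_res /= mod0n modn_small; last first.
  by rewrite -{1}[p]expn1 ltn_exp2l // prime_gt1.
by move=> p0; move: (prime_gt0 p_pr); rewrite p0.
Qed.

Lemma padic_p_nunit y : p%:R * y != 1.
Proof.
apply/eqP => /(congr1 (fun x : Zp => x 1%N)).
rewrite padic_mul_res padic_natr_res /= expn1 modnn mul0n mod0n modn_small //.
exact: prime_gt1.
Qed.

Lemma padic_1Dp_neq0 y : 1 + p%:R * y != 0.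
Proof.
apply/eqP => /eqP; rewrite addr_eq0 -mulrN eq_sym => /eqP e.
by have := padic_p_nunit (- y); rewrite e eqxx.
Qed.

(** Induction on a level at which x has a nonzero residue; removing a factor p lowers that level by
    one. *)
Lemma padic_factor x : x != 0 -> exists k u, x = p%:R ^+ k * u /\ u 1%N != 0%N.
Proof.
move=> /padic_neq0[a /(_ 0%N)]; rewrite addn0.
elim: a x => [|a IH] x; first by rewrite expn0 dvd1n.
have [/padic_dvdp[y ->]|x1] := eqVneq (x 1%N) 0%N; last first.
  by move=> _; exists 0%N, x; rewrite expr0 mul1r.
move=> Nd; have /IH[k [u [-> u1]]] : ~~ (p ^ a %| y a)%N.
  apply: contra Nd; rewrite padic_mul_res padic_natr_res modnMml padic_coherent.
  rewrite /dvdn modn_mod => yd; rewrite modn_mod expnS.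
  by rewrite -/(dvdn _ _) dvdn_pmul2l ?prime_gt0.
by exists k.+1, u; rewrite exprS mulrA.
Qed.

Lemma padic_torsion_coprime s d : ~~ (p %| d)%N ->
  (1 + p%:R * s) ^+ d = 1 -> p%:R * s = 0.
Proof.
move=> pd /eqP; rewrite -subr_eq0 subrX1 mulf_eq0 addrC addKr.
case/orP=> /eqP // S0; case/negP: pd.
have [r rE] := sum_exp1D (p%:R * s) d; rewrite S0 in rE.
have : d%:R = p%:R * - (s *+ 'C(d, 2) + s * (p%:R * s) * r) :> Zp.
  apply/eqP; rewrite mulrN -addr_eq0; rewrite rE; apply/eqP.
  by rewrite mulrDr mulrnAr addrA expr2 !mulrA.
move=> /(congr1 (fun x : Zp => x 1%N)).
by rewrite padic_mul_res !padic_natr_res expn1 modnn mul0n mod0n => /eqP.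
Qed.

Lemma padic_exp1Dp s n : exists t, (1 + p%:R * s) ^+ n = 1 + p%:R * t.
Proof.
elim: n => [|n [t IH]]; first by exists 0; rewrite mulr0 addr0.
exists (t * (1 + p%:R * s) + s).
by rewrite exprSr IH; ring.
Qed.

(** Strong induction on d. If d = e p, put w = (1 + p s)^e. Either w = 1 and e replaces d, or the
    geometric sum of w of length p vanishes, although it is p times an element of 1 + p Z_p. *)
Lemma padic_torsion_odd s d : odd p -> (0 < d)%N ->
  (1 + p%:R * s) ^+ d = 1 -> p%:R * s = 0.
Proof.
move=> p_odd; have [n] := ubnP d; elim: n d => // n IH d.
rewrite ltnS => dn d_gt0.
have [|Npd] := boolP (p %| d)%N; last exact: padic_torsion_coprime.
case/dvdnP=> e de; rewrite de in dn d_gt0 *.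
move: d_gt0; rewrite muln_gt0 => /andP[e_gt0 p_gt0].
rewrite exprM; have [t te] := padic_exp1Dp s e.
rewrite te => /eqP; rewrite -subr_eq0 subrX1 mulf_eq0 addrC addKr.
case/orP=> [/eqP pt0|/eqP S0].
  apply: (IH e) => //; last by rewrite te pt0 addr0.
  by apply: leq_trans dn; rewrite -{1}[e]muln1 ltn_pmul2l // prime_gt1.
have [r rE] := sum_exp1D (p%:R * t) p; rewrite S0 in rE.
(* Since p is odd, p divides C(p, 2), so the linear term of the sum is divisible by p^2. *)
have /dvdnP[c cE] : (p %| 'C(p, 2))%N.
  by apply: prime_dvd_bin => //=; rewrite odd_prime_gt2.
suff : p%:R * (1 + p%:R * (t *+ c + t ^+ 2 * r)) == 0 :> Zp.
  by rewrite mulf_eq0 (negPf padic_p_neq0) (negPf (padic_1Dp_neq0 _)).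
by apply/eqP; rewrite [RHS]rE cE; ring.
Qed.

(** For d = 2 e, induction applied to the square gives a fourth power equal to 1, so the square is 1
    or -1. The value -1 is excluded by (1 + 2 s)^2 + 1 = 2 (1 + 2 (s + s^2)). *)
Lemma padic2_torsion s d : p = 2%N -> (0 < d)%N ->
  (1 + p%:R * s) ^+ d = 1 -> (1 + p%:R * s) ^+ 2 = 1.
Proof.
move=> p2; have [n] := ubnP d; elim: n d s => // n IH d s.
rewrite ltnS => dn d_gt0.
have [|Npd] := boolP (p %| d)%N; last first.
  by move=> /(padic_torsion_coprime Npd) ->; rewrite addr0 expr1n.
move=> pd; have /dvdnP[e de] : (2 %| d)%N by rewrite -{1}p2.
rewrite de in dn d_gt0 *.
move: d_gt0; rewrite muln_gt0 andbT => e_gt0.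
rewrite mulnC exprM; have [t te] := padic_exp1Dp s 2; rewrite te => /IH.
rewrite (leq_trans _ dn) ?e_gt0; last by rewrite -{1}[e]muln1 ltn_pmul2l.
move=> /(_ isT isT) /eqP; rewrite -te sqrf_eq1 => /orP[/eqP //|/eqP sN1].
have : p%:R * (1 + p%:R * (s + s ^+ 2)) == 0 :> Zp.
  have pE : p%:R = 2%:R :> Zp by congr (1 *+ _).
  have -> : p%:R * (1 + p%:R * (s + s ^+ 2)) = (1 + p%:R * s) ^+ 2 + 1.
    by rewrite pE; ring.
  by rewrite sN1 addNr.
by rewrite mulf_eq0 (negPf padic_p_neq0) (negPf (padic_1Dp_neq0 _)).
Qed.

End PadicIntegers.

(** * Integers, maximal ideal and torsion of phase 1 in Q_p *)

Section PadicField.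
Variables (p : nat) (p_pr : prime p).
Local Notation Zp := (padic_int p_pr).
Local Notation Qp := ((padic p_pr)^o).
Local Notation O := (@padic_ext_integers p p_pr Qp).
Local Notation M := (max_ideal O).

Let emb : {rmorphism Zp -> Qp} := in_alg Qp \o @tofrac Zp.

Let embE (a : Zp) : emb a = tofrac a.
Proof. by rewrite /emb /= /GRing.scale /= mulr1. Qed.

Let emb_inj : injective emb.
Proof. by move=> a b; rewrite !embE => /eqP; rewrite tofrac_eq => /eqP. Qed.

Let emb_int a : O (emb a).
Proof. exact: (integral_id emb). Qed.

Let pQ0 : p%:R != 0 :> Qp.
Proof.
rewrite -(rmorph_nat emb) -(rmorph0 emb) (inj_eq emb_inj); exact: padic_p_neq0.
Qed.

(* Multiplying a monic equation of degree N for 1/p by p^N gives 1 in p Z_p. *)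
Lemma padic_p_inv_nonintegral : ~ O p%:R^-1.
Proof.
case=> q q_monic q0; have {}q0 : (map_poly emb q).[p%:R^-1] = 0 by exact/eqP.
have [N sq] : exists N, size q = N.+1.
  exists (size q).-1; rewrite prednK // size_poly_gt0; exact: monic_neq0.
have qN : q`_N = 1 by rewrite -(monicP q_monic) lead_coefE sq.
pose S : Zp := \sum_(i < N.+1) q`_i * p%:R ^+ (N - i).
have S0 : S = 0.
  apply: emb_inj; rewrite rmorph0.
  transitivity (p%:R ^+ N * (map_poly emb q).[p%:R^-1]); last by rewrite q0 mulr0.
  rewrite rmorph_sum.
  rewrite (@horner_coef_wide _ N.+1); last by rewrite -sq size_poly.
  rewrite mulr_sumr; apply: eq_bigr => i _.
  rewrite coef_map rmorphM rmorphXn rmorph_nat mulrCA; congr (_ * _).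
  have iN : (i <= N)%N by rewrite -ltnS.
  by rewrite -[X in _ = _ ^+ X * _](subnK iN) exprD exprVn mulfK ?expf_neq0.
pose t : Zp := \sum_(i < N) q`_i * p%:R ^+ (N - i).-1.
have := padic_p_nunit (- t); rewrite mulrN; apply/negP; rewrite negbK eq_sym -addr_eq0.
rewrite -[X in _ == X]S0 /S big_ord_recr /= qN subnn mulr1 addrC mulr_sumr; apply/eqP.
congr (_ + _); apply: eq_bigr => i _; rewrite mulrCA -exprS prednK //.
by rewrite subn_gt0.
Qed.

(** Write x = a / p^k and cancel factors p. If a is a unit while k > 0, then 1/p is x times an
    element of Z_p, hence integral, a contradiction. *)
Lemma padic_integral_closure (x : Qp) : O x -> exists a, x = emb a.
Proof.
have int_div k a : O (emb a / p%:R ^+ k) -> exists b, emb a / p%:R ^+ k = emb b.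
  elim: k a => [|k IH] a Oa; first by exists a; rewrite expr0 divr1.
  have [/padic_dvdp[b ab]|/padic_unit[b ab]] := eqVneq (a 1%N) 0%N.
    have e : emb a / p%:R ^+ k.+1 = emb b / p%:R ^+ k.
      by rewrite ab rmorphM rmorph_nat exprS -mulf_div divff // mul1r.
    by rewrite e in Oa *; exact: IH.
  case: padic_p_inv_nonintegral.
  have -> : p%:R^-1 = emb a / p%:R ^+ k.+1 * emb (b * p%:R ^+ k).
    rewrite mulrAC -rmorphM mulrA [a * b]mulrC ab mul1r rmorphXn rmorph_nat.
    by rewrite exprSr invfM mulrA divff ?mul1r // expf_neq0.
  by apply: padic_ext_integersM; [exact: Oa|exact: emb_int].
move=> Ox; have [a [b [b0 xb]]] := fraction_numden x.
have [k [u [bE /padic_unit[v vu]]]] := padic_factor b0.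
have xE : x = emb (a * v) / p%:R ^+ k.
  apply: (mulIf (x := emb b)); first by rewrite embE tofrac_eq0.
  rewrite [LHS](_ : _ = emb a); last by rewrite !embE.
  rewrite bE [emb (_ * u)]rmorphM rmorphXn rmorph_nat mulrA.
  by rewrite divfK ?expf_neq0 // -rmorphM -mulrA vu mulr1.
by rewrite xE in Ox *; exact: int_div.
Qed.

Lemma padic_max_ideal (x : Qp) : M x -> exists s, x = emb (p%:R * s).
Proof.
case=> /padic_integral_closure[a ->] Na.
have [/padic_dvdp[s ->]|/padic_unit[b ab]] := eqVneq (a 1%N) 0%N.
  by exists s.
case: Na; split; first exact: emb_int.
exists (emb b); first exact: emb_int.
by rewrite -rmorphM mulrC ab rmorph1.
Qed.

Lemma padic_max_ideal_p (s : Zp) : M (emb (p%:R * s)).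
Proof.
split; first exact: emb_int.
case=> _ [y Oy py]; apply: padic_p_inv_nonintegral.
have -> : p%:R^-1 = emb s * y.
  by apply: (mulfI pQ0); rewrite divff // mulrA -{1}(rmorph_nat emb) -rmorphM py.
by apply: padic_ext_integersM; [exact: emb_int|exact: Oy].
Qed.

Section Phase.
Variable rho : Qp.
Hypothesis rho_unif : uniformizer O rho.

(** Moves the torsion question from Q_p to 1 + p Z_p. *)
Let phase_torsion (z : Qp) d : (0 < d)%N -> nonarch_phase_eq1 O rho z ->
  z ^+ d = 1 -> exists s, z = emb (1 + p%:R * s) /\ (1 + p%:R * s) ^+ d = 1.
Proof.
move=> d_gt0 z1 zd.
have /padic_max_ideal[s zs] : M (z - 1).
  apply: (nonarch_phase_torsion _ _ _ rho_unif d_gt0 z1 zd).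
  - exact: padic_ext_integers1.
  - exact: padic_ext_integersB.
  - exact: padic_ext_integersM.
have zE : z = emb (1 + p%:R * s) by rewrite rmorphD rmorph1 -zs addrC subrK.
exists s; split=> //; apply: emb_inj.
by rewrite rmorphXn -zE zd rmorph1.
Qed.

Lemma padic_odd_phase_torsion (z : Qp) d : odd p -> (0 < d)%N ->
  nonarch_phase_eq1 O rho z -> z ^+ d = 1 -> z = 1.
Proof.
move=> p_odd d_gt0 z1 /(phase_torsion d_gt0 z1)[s [-> sd]].
by rewrite (padic_torsion_odd p_odd d_gt0 sd) addr0 rmorph1.
Qed.

Lemma padic2_phase_torsion (z : Qp) d : p = 2%N -> (0 < d)%N ->
  nonarch_phase_eq1 O rho z -> z ^+ d = 1 -> z ^+ 2 = 1.
Proof.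
move=> p2 d_gt0 z1 /(phase_torsion d_gt0 z1)[s [-> sd]].
by rewrite -rmorphXn (padic2_torsion p2 d_gt0 sd) rmorph1.
Qed.

Lemma padic2_phaseN1 : p = 2%N -> nonarch_phase_eq1 O rho (-1).
Proof.
move=> p2; apply/(nonarch_phaseP _ _ _ rho_unif).
- exact: padic_ext_integers1.
- exact: padic_ext_integersB.
- exact: padic_ext_integersM.
(* The exponent 0 works because -1 - 1 = -2 lies in the maximal ideal. *)
exists 0; rewrite divr1; have -> : -1 - 1 = emb (p%:R * -1).
  rewrite mulrN1 rmorphN rmorph_nat -opprD; congr (- _).
  by rewrite -(natrD _ 1 1); congr (1 *+ _).
exact: padic_max_ideal_p.
Qed.

End Phase.

Lemma padic2_natr2_neq0 : p = 2%N -> 2%:R != 0 :> Qp.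
Proof. by move=> p2; rewrite -{1}p2; exact: pQ0. Qed.

End PadicField.

(** * Torsion of phase 1 in Laurent series fields *)

Section LaurentSeriesNat.
Variable F : fieldType.

Lemma fps_natr (d n : nat) : (d%:R : fps F) n = if n == 0%N then d%:R else 0.
Proof.
elim: d => [|d IH]; first by case: ifP.
rewrite mulrS [LHS]/= IH; case: eqP => //= _; last by rewrite addr0.
by rewrite [RHS]mulrS.
Qed.

(** An integer nonzero in the series field is nonzero in F, and the constant series of its inverse
    inverts it. *)
Lemma laurent_series_natr_unit d : d%:R != 0 :> laurent_series F ->
  int_unit (@laurent_series_integers F) d%:R.
Proof.
move=> dn0; have e : d%:R = tofrac (d%:R : fps F) :> laurent_series F.
  by rewrite rmorph_nat.
have c0 : d%:R != 0 :> F.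
  apply: contraNneq dn0 => d0; rewrite e tofrac_eq0; apply/eqP/fpsP => n.
  by rewrite fps_natr d0; case: ifP.
split; first by exists d%:R.
pose c : fps F := Fps (fun n => if n == 0%N then d%:R^-1 else 0).
exists (tofrac c); first by exists c.
rewrite e -tofracM -[RHS]tofrac1; congr tofrac; apply: fpsP => n.
rewrite [LHS]big_ord_recl big1 => [|i _]; last by rewrite fps_natr mul0r.
rewrite addr0 fps_natr /= subn0; case: eqP => _; last by rewrite mulr0.
by rewrite divff.
Qed.

End LaurentSeriesNat.

Lemma laurent_series_phase_torsion (F : fieldType) (rho z : laurent_series F) d :
  uniformizer (@laurent_series_integers F) rho -> (0 < d)%N ->
  d%:R != 0 :> laurent_series F ->
  nonarch_phase_eq1 (@laurent_series_integers F) rho z -> z ^+ d = 1 -> z = 1.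
Proof.
move=> rho_unif d_gt0 dn0 z1 zd.
apply: (one_units_unit_torsion _ _ _ rho_unif (laurent_series_natr_unit dn0) _ zd).
- exact: laurent_series_integers1.
- exact: laurent_series_integersB.
- exact: laurent_series_integersM.
apply: (nonarch_phase_torsion _ _ _ rho_unif d_gt0 z1 zd).
- exact: laurent_series_integers1.
- exact: laurent_series_integersB.
- exact: laurent_series_integersM.
Qed.

(** * Archimedean torsion and the explicit values of Y *)

Lemma arch_phase_torsion (K : numFieldType) (z : K) d : (0 < d)%N ->
  z != 0 -> arch_phase z = 1 -> z ^+ d = 1 -> z = 1.
Proof.
move=> d_gt0 z0 /(arch_phase_eq1 z0)/ltW z_ge0 /eqP.
by rewrite pexpr_eq1 // => /eqP.
Qed.

Lemma Y_eq1 (R : realType) (K : local_field R) n : (0 < n)%N ->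
  (forall d (z : K), (0 < d)%N -> d%:R != 0 :> K -> phase1 z -> z ^+ d = 1 -> z = 1) ->
  Y K n 1 = 1%E.
Proof.
move=> n_gt0 tor.
have c1 d : d%:R != 0 :> K -> phase1_unity K d = [fset 1]%fset.
  move=> dn0; have d_gt0 := natr_neq0_gt0 dn0.
  apply/fsetP => z; rewrite !inE; apply/idP/eqP => [/(phase1_unityP _ d_gt0)[z1 zd]|->].
    exact: (tor d).
  by apply/phase1_unityP; rewrite ?expr1n //; split=> //; exact: phase1_1.
rewrite (Y_max (@phase1M R K) (@phase1V R K) n_gt0 (N := 1)) ?exp1n //.
  by move=> d /c1 ->; rewrite cardfs1.
by exists 1%N; rewrite ?c1 ?cardfs1 ?oner_neq0.
Qed.

(** The maximum 2 is attained at d = 2, by 1 and -1, which differ because 2 is nonzero in K. *)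
Lemma Y_eq2 (R : realType) (K : local_field R) n : (0 < n)%N ->
  2%:R != 0 :> K -> phase1 (-1 : K) ->
  (forall d (z : K), (0 < d)%N -> phase1 z -> z ^+ d = 1 -> z ^+ 2 = 1) ->
  Y K n 1 = (2 ^ n)%N%:R%:E.
Proof.
move=> n_gt0 two0 N1 tor.
have unity2 : phase1_unity K 2 = [fset 1; -1]%fset.
  apply/fsetP => z; rewrite !inE -sqrf_eq1.
  apply/idP/eqP => [/(phase1_unityP _ (isT : 0 < 2)%N)[]//|z2].
  apply/phase1_unityP => //; split=> //; move/eqP: z2; rewrite sqrf_eq1.
  by case/orP=> /eqP-> //; exact: phase1_1.
have card2 : #|` phase1_unity K 2| = 2%N.
  by rewrite unity2 cardfs2 -subr_eq0 opprK -mulr2n two0.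
apply: (Y_max (@phase1M R K) (@phase1V R K) n_gt0 (N := 2)) => [d dn0|].
  have d_gt0 := natr_neq0_gt0 dn0.
  rewrite -[leqRHS]card2; apply/fsubset_leq_card/fsubsetP => z.
  move=> /(phase1_unityP _ d_gt0)[z1 zd].
  by apply/phase1_unityP => //; split=> //; exact: (tor d).
by exists 2%N.
Qed.

Theorem proposition1p4 (R : realType) :
  (forall (L : local_field R) (n : nat) (k : int),
     (1 <= n)%N -> k <= 0 -> Y L n k = 0%E) /\
  (forall (L : local_field R) (n : nat),
     (1 <= n)%N -> Y L n 1 = (Y L 1 1 ^+ n)%E) /\
  (forall (pr2 : prime 2) (rho : (padic pr2)^o)
     (rho_unif : uniformizer (@padic_ext_integers 2 pr2 (padic pr2)^o) rho)
     (n : nat), (1 <= n)%N ->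
     Y (LocalPadicExt rho_unif : local_field R) n 1 = ((2 ^ n)%N%:R)%:E) /\
  (forall n : nat, (1 <= n)%N ->
     [/\ Y (LocalComplex : local_field R) n 1 = 1%E,
         Y (LocalReal : local_field R) n 1 = 1%E,
         (forall (p : nat) (p_pr : prime p) (rho : (padic p_pr)^o)
            (rho_unif : uniformizer
                          (@padic_ext_integers p p_pr (padic p_pr)^o) rho),
            odd p -> Y (LocalPadicExt rho_unif : local_field R) n 1 = 1%E)
       & (forall (F : finFieldType) (rho : laurent_series F)
            (rho_unif : uniformizer (@laurent_series_integers F) rho),
            Y (LocalLaurentSeries rho_unif : local_field R) n 1 = 1%E)]).
Proof.
split; first by move=> L n k; exact: Y_le0.
split; first by move=> L n; apply: Y_exp; [exact: phase1M|exact: phase1V].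
split=> [pr2 rho rho_unif n n_gt0|n n_gt0].
  apply: Y_eq2 => // [||d z d_gt0 [_ z1] zd].
  - exact: padic2_natr2_neq0.
  - by split; [rewrite oppr_eq0 oner_neq0|exact: (padic2_phaseN1 rho_unif)].
  - exact: (padic2_phase_torsion rho_unif _ d_gt0 z1 zd).
split=> [||p p_pr rho rho_unif p_odd|F rho rho_unif];
    apply: Y_eq1 => // d z d_gt0 dn0 [z0 z1] zd.
- exact: arch_phase_torsion zd.
- exact: arch_phase_torsion zd.
- exact: (padic_odd_phase_torsion rho_unif p_odd d_gt0 z1 zd).
- exact: (laurent_series_phase_torsion rho_unif d_gt0 dn0 z1 zd).
Qed.
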